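(* Let $(X,d)$ be a compact metric space, let $f_1,f_2:X\to X$ be continuous maps, and let $F=\{f_1,f_2\}$ be the associated multiple mappings. Suppose there is a point $c\in X$ such that $f_1(x)=c$ for all $x\in X$ and $f_2(c)=c$. If $f_2$ is transitive, then $F$ is transitive.
   Context: A continuous map $f:X\to X$ is (topologically) transitive if for any nonempty open sets $U,V\subset X$ there exists an integer $n\ge 1$ such that $f^n(U)\cap V\neq\emptyset$. For $F=\{f_1,f_2\}$, an integer $n>0$ and $x\in X$, put $$F^n(x)=\{f_{i_1}f_{i_2}\cdots f_{i_n}(x)\mid i_1,\dots,i_n\in\{1,2\}\}\subset X,$$ where juxtaposition denotes composition; in particular $F(x)=F^1(x)=\{f_1(x),f_2(x)\}$. Let $\mathbb{K}(X)$ be the set of nonempty compact subsets of $X$, with the Hausdorff metric $$d_H(A,B)=\max\Big\{\sup_{a\in A}\inf_{b\in B}d(a,b),\ \sup_{b\in B}\inf_{a\in A}d(a,b)\Big\},$$ and let $Ran(F)=\{F^n(x)\mid n\ge 1,\ x\in X\}\subset\mathbb{K}(X)$, with the subspace topology induced by $d_H$. $F$ is (topologically) transitive if for any nonempty open set $U\subset X$ and any nonempty open set $\mathcal{U}\subset Ran(F)$ (open in $Ran(F)$), there exists an integer $n\ge 1$ such that $\{F^n(u)\mid u\in U\}\cap\mathcal{U}\neq\emptyset$. *)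

(* Defs.v *)
From HB Require Import structures.
From mathcomp Require Import all_boot all_order all_algebra.
From mathcomp Require Import all_classical all_reals all_analysis.
Set Implicit Arguments.
Unset Strict Implicit.
Unset Printing Implicit Defensive.
Import Order.TTheory GRing.Theory Num.Theory.
Import numFieldNormedType.Exports.
Local Open Scope classical_set_scope.
Local Open Scope ring_scope.

Definition top_transitive (X : topologicalType) (f : X -> X) : Prop :=
  forall U V : set X, open U -> U !=set0 -> open V -> V !=set0 ->
  exists2 n : nat, (1 <= n)%N & (iter n f @` U) `&` V !=set0.

Record compacts (R : realType) (X : metricType R) := Compacts {
  cset :> set X;
  cset_compact : compact cset;
  cset_nonempty : cset !=set0 }.

HB.instance Definition _ (R : realType) (X : metricType R) :=
  gen_eqMixin (compacts X).
HB.instance Definition _ (R : realType) (X : metricType R) :=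
  gen_choiceMixin (compacts X).

Definition hausdorff_dist (R : realType) (X : metricType R) (A B : set X) : R :=
  Num.max (sup [set inf [set mdist a b | b in B] | a in A])
          (sup [set inf [set mdist a b | a in A] | b in B]).

Section hausdorff_metric.
Context {R : realType} {X : metricType R}.
Implicit Types (A B C : compacts X) (a b c x y : X) (e : R).

Definition infdist a B : R := inf [set mdist a b | b in cset B].
Definition excess A B : R := sup [set infdist a B | a in cset A].

Lemma dist_hasinf a B : has_inf [set mdist a b | b in cset B].
Proof.
have [b Bb] := cset_nonempty B; split; first by exists (mdist a b), b.
by exists 0 => _ [y _ <-]; exact: mdist_ge0.
Qed.

Lemma infdist_le a b B : cset B b -> infdist a B <= mdist a b.
Proof.
by move=> Bb; apply: ge_inf; [have [] := dist_hasinf a B | exists b].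
Qed.

Lemma infdist_ge0 a B : 0 <= infdist a B.
Proof.
apply: lb_le_inf; first by have [] := dist_hasinf a B.
by move=> _ [y _ <-]; exact: mdist_ge0.
Qed.

Lemma infdist_adh a B e : 0 < e -> exists2 b, cset B b & mdist a b < infdist a B + e.
Proof.
move=> e0; have [_ [b Bb <-] h] := inf_adherent e0 (dist_hasinf a B).
by exists b.
Qed.

Lemma mdist_continuous x : continuous (fun y => mdist x y : R^o).
Proof.
move=> y; apply/cvgrPdist_lt => e e0; near=> z.
have yz : mdist y z < e.
  near: z; apply/nbhs_ballP; exists e => //= z; by rewrite ballEmdist.
rewrite (le_lt_trans _ yz)// ler_norml lerBlDr lerBrDr.
have h1 := metric_triangle x z y; have h2 := metric_triangle x y z.
rewrite (metric_sym z y) in h1.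
by rewrite addrC lerBlDr h2 addrC h1.
Unshelve. all: by end_near. Qed.

Lemma mdist_bounded A x : exists M, forall a, cset A a -> mdist x a <= M.
Proof.
have := continuous_compact (continuous_subspaceT (@mdist_continuous x))
  (@cset_compact _ _ A).
move=> /compact_bounded [M [_ MA]].
exists (M + 1) => a Aa; apply: (le_trans (ler_norm _)).
by apply: MA; [rewrite ltrDl | exists a].
Qed.

Lemma infdist_hassup A B : has_sup [set infdist a B | a in cset A].
Proof.
have [a Aa] := cset_nonempty A; split; first by exists (infdist a B), a.
have [b Bb] := cset_nonempty B; have [M MA] := mdist_bounded A b.
exists M => _ [y Ay <-]; apply: (le_trans (infdist_le y Bb)).
by rewrite metric_sym MA.
Qed.

Lemma le_excess A B a : cset A a -> infdist a B <= excess A B.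
Proof.
by move=> Aa; apply: ub_le_sup; [have [] := infdist_hassup A B | exists a].
Qed.

Lemma excess_le A B e : (forall a, cset A a -> infdist a B <= e) -> excess A B <= e.
Proof.
move=> h; apply: ge_sup; first by have [] := infdist_hassup A B.
by move=> _ [a Aa <-]; exact: h.
Qed.

Lemma excess_triangle B A C : excess A C <= excess A B + excess B C.
Proof.
apply: excess_le => a Aa; apply: le_trans (_ : infdist a B + excess B C <= _).
  apply/ler_addgt0Pr => e e0; have e20 : 0 < e / 2 by rewrite divr_gt0.
  have [b Bb ab] := infdist_adh a B e20.
  have [c Cc bc] := infdist_adh b C e20.
  apply: (le_trans (infdist_le a Cc)); apply: (le_trans (metric_triangle a b c)).
  apply: (le_trans (ltW (ltrD ab bc))).
  by rewrite addrACA -splitr lerD2r lerD2l le_excess.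
by rewrite lerD2r le_excess.
Qed.

Lemma excess_ge0 A B : 0 <= excess A B.
Proof.
have [a Aa] := cset_nonempty A.
exact: le_trans (infdist_ge0 a B) (le_excess B Aa).
Qed.

Lemma excess0_sub A B : excess A B <= 0 -> cset A `<=` cset B.
Proof.
move=> AB0 a Aa.
apply: (compact_closed (@metric_hausdorff _ X) (@cset_compact _ _ B)).
move=> N /nbhs_ballP [e /= e0 aeN].
have [b Bb ab] := infdist_adh a B e0; exists b; split => //.
apply: aeN; rewrite ballEmdist /=; apply: (lt_le_trans ab).
by rewrite gerDr (le_trans (le_excess B Aa)).
Qed.

Lemma hausdorff_distE A B : hausdorff_dist A B = Num.max (excess A B) (excess B A).
Proof.
rewrite /hausdorff_dist; congr (Num.max _ (sup _)).
apply/eq_imagel => b _; congr inf; apply/eq_imagel => a _; exact: metric_sym.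
Qed.

Lemma hausdorff_distxx A : hausdorff_dist A A = 0.
Proof.
rewrite hausdorff_distE maxxx; apply/le_anti; rewrite excess_ge0 andbT.
by apply: excess_le => a Aa; rewrite -(mdistxx a) infdist_le.
Qed.

Lemma hausdorff_dist_positivity A B : hausdorff_dist A B = 0 -> A = B.
Proof.
rewrite hausdorff_distE => AB.
have [AB0 BA0] : excess A B <= 0 /\ excess B A <= 0.
  by split; rewrite -AB le_max lexx ?orbT.
have : cset A = cset B by apply/seteqP; split; exact: excess0_sub.
case: A B {AB AB0 BA0} => [A cA A0] [B cB B0] /= AB; case: _ / AB in cB B0 *.
by congr Compacts; exact: Prop_irrelevance.
Qed.

Lemma hausdorff_dist_sym A B : hausdorff_dist A B = hausdorff_dist B A.
Proof. by rewrite !hausdorff_distE maxC. Qed.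

Lemma hausdorff_dist_triangle B A C :
  hausdorff_dist A C <= hausdorff_dist A B + hausdorff_dist B C.
Proof.
rewrite !hausdorff_distE ge_max; apply/andP; split.
  by apply: (le_trans (excess_triangle B A C)); rewrite lerD// le_max lexx.
apply: (le_trans (excess_triangle B C A)).
by rewrite addrC lerD// le_max lexx orbT.
Qed.

HB.instance Definition _ := isMetric.Build R (compacts X)
  hausdorff_distxx hausdorff_dist_positivity hausdorff_dist_sym
  hausdorff_dist_triangle.

End hausdorff_metric.

Section multiple_mappings.
Context {R : realType} {X : metricType R}.
Variables f1 f2 : X -> X.

Definition mm_map (i : bool) : X -> X := if i then f2 else f1.

(* foldr mm_map x [:: i1; ...; in] is f_i1 (f_i2 (... (f_in x))), so the words
   w of length n enumerate the compositions f_i1 f_i2 ... f_in. *)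
Definition mm_iter_set (n : nat) (x : X) : set X :=
  [set foldr mm_map x w | w in [set: n.-tuple bool]].

Lemma mm_iter_set_compact n x : compact (mm_iter_set n x).
Proof. by apply: finite_compact; exact/finite_image/finite_finset. Qed.

Lemma mm_iter_set_nonempty n x : mm_iter_set n x !=set0.
Proof. by exists (foldr mm_map x (nseq_tuple n true)), (nseq_tuple n true). Qed.

Definition mm_iter (n : nat) (x : X) : compacts X :=
  Compacts (@mm_iter_set_compact n x) (@mm_iter_set_nonempty n x).

Definition mm_ran : set (compacts X) :=
  [set A | exists (n : nat) (x : X), (1 <= n)%N /\ A = mm_iter n x].

(* In subspace mm_ran every point outside mm_ran is isolated, hence the
   separate hypothesis that W is included in mm_ran. *)
Definition mm_transitive : Prop :=
  forall (U : set X) (W : set (compacts X)),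
  open U -> U !=set0 ->
  W `<=` mm_ran -> open (W : set (subspace mm_ran)) -> W !=set0 ->
  exists2 n : nat, (1 <= n)%N & [set mm_iter n u | u in U] `&` W !=set0.

End multiple_mappings.

(* Main.v *)
Require Import Defs.
From HB Require Import structures.
From mathcomp Require Import all_boot all_order all_algebra.
From mathcomp Require Import all_classical all_reals all_analysis.
Set Implicit Arguments.
Unset Strict Implicit.
Unset Printing Implicit Defensive.
Import Order.TTheory GRing.Theory Num.Theory.
Import numFieldNormedType.Exports.
Local Open Scope classical_set_scope.
Local Open Scope ring_scope.

(** Every word in f1, f2 containing the letter f1 is constantly c, so
    F^n(x) = {c, f2^n(x)} for n >= 1. Sharing the point c, the sets F^n(u) and
    F^m(y) are at Hausdorff distance at most d(f2^n(u), f2^m(y)), which the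
    transitivity of f2 makes arbitrarily small. *)

(** The common point [c] is matched with itself at distance 0, and [a] is matched with [b]. *)
Lemma excess_pair_le (R : realType) (X : metricType R) (A B : compacts X)
    (c a b : X) :
  cset A = [set c; a] -> cset B = [set c; b] -> excess A B <= mdist a b.
Proof.
move=> eA eB; apply: excess_le => x; rewrite eA => -[->|->].
  apply: le_trans (mdist_ge0 a b); rewrite -(mdistxx c).
  by apply: infdist_le; rewrite eB; left.
by apply: infdist_le; rewrite eB; right.
Qed.

Lemma hausdorff_pair_le (R : realType) (X : metricType R) (A B : compacts X)
    (c a b : X) :
  cset A = [set c; a] -> cset B = [set c; b] -> mdist A B <= mdist a b.
Proof.
move=> eA eB; rewrite [mdist A B]hausdorff_distE ge_max.
by rewrite (excess_pair_le eA eB) (metric_sym a b) (excess_pair_le eB eA).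
Qed.

Section constant_map.
Context {R : realType} {X : metricType R}.
Variables (f1 f2 : X -> X) (c : X).
Hypotheses (f1c : forall x, f1 x = c) (f2c : f2 c = c).

(** An application of [f1] forgets everything before it and yields [c], where later applications of
    [f2] stay because [c] is fixed. The test [all id w] says that only [f2] occurs. *)
Lemma foldr_mm_map (w : seq bool) (x : X) :
  foldr (mm_map f1 f2) x w = if all id w then iter (size w) f2 x else c.
Proof. by elim: w => [//|[] w /= ->] //; case: ifP. Qed.

Lemma mm_iter_setE (n : nat) (x : X) :
  (1 <= n)%N -> mm_iter_set f1 f2 n x = [set c; iter n f2 x].
Proof.
move=> n1; apply/seteqP; split=> [_ [w _ <-]|_ [->|->]].
- by rewrite foldr_mm_map size_tuple; case: ifP; [right|left].
(* The word of [n] letters [f1] gives [c] because [n] is positive; for [n = 0] the set would be the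
   singleton of [x]. *)
- exists (nseq_tuple n false) => //; rewrite foldr_mm_map /=.
  by case: n n1.
- by exists (nseq_tuple n true) => //; rewrite foldr_mm_map all_nseq orbT size_nseq.
Qed.

End constant_map.

Theorem theorem3p7 (R : realType) (X : metricType R) (f1 f2 : X -> X) (c : X) :
  compact [set: X] -> continuous f1 -> continuous f2 ->
  (forall x : X, f1 x = c) -> f2 c = c ->
  top_transitive f2 -> mm_transitive f1 f2.
Proof.
move=> _ _ _ f1c f2c f2T U W oU U0 WR /open_subspaceP[V oV VW] [A WA].
have [m [y [m1 eA]]] : mm_ran f1 f2 A by exact: WR.
have [VA _] : (V `&` mm_ran f1 f2) A by rewrite VW; split=> //; exact: WR.
have /nbhs_ballP[e /= e0 AeV] : nbhs A V by exact: open_nbhs_nbhs.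
set z := iter m f2 y.
(* The transitivity of [f2] is applied to [U] and a neighbourhood of [z], the free point of [A]; the
   time [n] it returns need not equal [m]. *)
have z0 : (ball z e)° !=set0 by exists z; exact: nbhsx_ballx.
have [n n1 [_ [[u Uu <-] /interior_subset zu]]] :=
  f2T _ _ oU U0 (open_interior (ball z e)) z0.
exists n => //; exists (mm_iter f1 f2 n u); split; first by exists u.
have : (V `&` mm_ran f1 f2) (mm_iter f1 f2 n u).
  split; last by exists n, u.
  (* The radius [e] chosen for sets around [A] also serves for points around [z], since passing to
     the pairs does not increase distances. *)
  apply: AeV; rewrite ballEmdist /=.
  rewrite ballEmdist /= in zu; apply: le_lt_trans zu; rewrite eA.
  by apply: (hausdorff_pair_le (c := c)); exact: mm_iter_setE.
by rewrite VW => -[].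
Qed.
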